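(* Let $E$ be a finite set and let $\hat{M}=(\mathbb{R}_{\max}\times E)/(\{-\infty\}\times E)$. The map sending a valuated matroid on $E$ to its closure operator $\mathrm{cl}$ on $\hat M$ is a one-to-one correspondence between valuated matroids on $E$ and algebraic closure operators $\mathrm{cl}$ on $\hat{M}$ satisfying all of the following: (1) $\mathbf{0}\in\mathrm{cl}(\emptyset)$. (2) For any $S\subseteq \hat{M}$ and $a\in \mathbb{R}_{\max}^\times$, $\mathrm{cl}(aS) = a\, \mathrm{cl}(S)$. (3) For any $S\subseteq \hat{M}$, $\mathrm{cl}(S)$ is downward closed. (4) Let $S\subseteq\hat{M}$, $x,y\in E$ and $a\in \mathbb{R}_{\max}$. Suppose there is some $b\in \mathbb{R}_{\max}$ such that $ax\in \mathrm{cl}(S\cup\{by\})$. Then there is some $c\in\mathbb{R}_{\max}$ with $c\leq b$ such that $ax\in \mathrm{cl}(S\cup\{cy\})$ and $cy\in \mathrm{cl}(S \cup\{ax\})$. (5) Let $S\subseteq\hat{M}$, $x\in E$ and $a, b\in \mathbb{R}_{\max}$. Suppose $ax\in \mathrm{cl}(S \cup \{bx\})$ and $b < a$. Then $ax\in \mathrm{cl}(S)$.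
   Context: Tropical semifield: $\mathbb{R}_{\max}=\mathbb{R}\cup\{-\infty\}$ with addition $\max$ and multiplication the usual addition of real numbers, written multiplicatively; its zero is $-\infty$, its multiplicative unit (the real number $0$) is written $1$, $\mathbb{R}_{\max}^\times=\mathbb{R}$, and the order is the usual one. Valuated matroid on a finite set $E$ (circuit description): a collection $\mathcal{C}\subseteq \mathbb{R}_{\max}^E$ of functions, called circuits, such that, writing $\underline{X}=\{e\in E\mid X(e)\ne-\infty\}$: the constant function $-\infty$ is not in $\mathcal{C}$; if $X,Y\in\mathcal{C}$ and $\underline X\neq\underline Y$ then $\underline X\not\subseteq\underline Y$; if $X\in\mathcal{C}$ and $a\in\mathbb{R}_{\max}^\times$ then $aX\in\mathcal{C}$; and for $X,Y\in\mathcal{C}$ and $u,v\in E$ with $X(u)=Y(u)\neq-\infty$ and $X(v)>Y(v)$ there is $Z\in\mathcal{C}$ with $Z(u)=-\infty$, $Z(v)=X(v)$ and $Z\le\max(X,Y)$ pointwise. Two valuated matroids on $E$ are equal if they have the same circuits. The set $\hat M$: $\mathbb{R}_{\max}\times E$ with $\{-\infty\}\times E$ collapsed to one point $\mathbf{0}$; so $\hat M=\{\mathbf 0\}\sqcup(\mathbb{R}\times E)$. The class of $(a,x)$ is written $ax$, and $\mathbb{R}_{\max}$ acts by $b(ax)=(ba)x$; $aS=\{as\mid s\in S\}$. Partial order: $ax\le by$ iff either both are $\mathbf 0$, or $x=y$ and $a\le b$ (in particular $\mathbf 0=(-\infty)x\le bx$ for all $b,x$). A subset is downward closed if it contains every element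 below one of its elements. A circuit set is a subset of $\hat M$ of the form $\{c(x)x\mid x\in E,\ c(x)\neq-\infty\}$ for a circuit $c$. A flat is a nonempty downward closed subset $F\subseteq\hat M$ such that for every circuit set $C$ and $u\in C$, if $C\setminus\{u\}\subseteq F$ then $u\in F$. The closure operator of the valuated matroid sends $S\subseteq\hat M$ to the intersection of all flats containing $S$. An algebraic closure operator on a set $X$ is a map $\mathrm{cl}:2^X\to2^X$ with $A\subseteq\mathrm{cl}(A)$; $A\subseteq B\Rightarrow\mathrm{cl}(A)\subseteq\mathrm{cl}(B)$; $\mathrm{cl}(\mathrm{cl}(A))=\mathrm{cl}(A)$; and $\mathrm{cl}(A)=\bigcup\mathrm{cl}(F)$ over finite subsets $F\subseteq A$. *)

(* Defs.v *)
From mathcomp Require Import all_boot all_order all_algebra.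
From mathcomp Require Import all_classical all_reals.

Set Implicit Arguments.
Unset Strict Implicit.
Unset Printing Implicit Defensive.

Import Order.TTheory GRing.Theory Num.Theory.
Local Open Scope classical_set_scope.
Local Open Scope ring_scope.

Section Rmax.
Context {R : realType}.

(* The tropical semifield: [None] is -oo, the zero; [Some r] is the unit r. *)
Definition Rmax : Type := option R.

Definition rmax_le (a b : Rmax) : bool :=
  match a, b with
  | None, _ => true
  | Some _, None => false
  | Some r, Some s => r <= s
  end.

Definition rmax_lt (a b : Rmax) : bool := ~~ rmax_le b a.

Definition rmax_add (a b : Rmax) : Rmax := if rmax_le a b then b else a.

(* Tropical multiplication is addition of real numbers. *)
Definition rmax_mul (a b : Rmax) : Rmax :=
  match a, b with
  | Some r, Some s => Some (r + s)
  | _, _ => None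
  end.

End Rmax.
Arguments Rmax R : clear implicits.

Section ValuatedMatroid.
Context {R : realType} {E : finType}.

Definition rsupp (X : E -> Rmax R) : set E := [set e | X e <> None].

(* A valuated matroid is identified with its set of circuits, so that equality
   of valuated matroids is equality of sets. *)
Record valuated_matroid (C : set (E -> Rmax R)) : Prop := ValuatedMatroid {
  vm_nonzero : ~ C (fun=> None);
  vm_incomparable : forall X Y, C X -> C Y ->
    rsupp X <> rsupp Y -> ~ (rsupp X `<=` rsupp Y);
  vm_scale : forall X (a : R), C X -> C (fun e => rmax_mul (Some a) (X e));
  vm_elim : forall X Y u v, C X -> C Y ->
    X u = Y u -> X u <> None -> rmax_lt (Y v) (X v) ->
    exists Z, [/\ C Z, Z u = None, Z v = X v &
                  forall e, rmax_le (Z e) (rmax_add (X e) (Y e))]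
}.

End ValuatedMatroid.

(* The quotient of Rmax x E collapsing {-oo} x E to the point [None], i.e. the
   disjoint union of this point and R x E.  The point is present even when E is
   empty. *)
Definition Mhat (R : realType) (E : finType) : Type := option (R * E).

Section Closure.
Context {R : realType} {E : finType}.

Definition mzero : Mhat R E := None.

(* The class ax of (a, x). *)
Definition mpt (a : Rmax R) (x : E) : Mhat R E :=
  if a is Some r then Some (r, x) else mzero.

Definition mscale (b : Rmax R) (p : Mhat R E) : Mhat R E :=
  if p is Some (r, x) then mpt (rmax_mul b (Some r)) x else mzero.

Definition mle (p q : Mhat R E) : Prop :=
  (p = mzero /\ q = mzero) \/
  exists x a b, [/\ p = mpt a x, q = mpt b x & rmax_le a b].

Definition down_closed (F : set (Mhat R E)) : Prop :=
  forall p q, mle p q -> F q -> F p.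

Definition circuit_set (c : E -> Rmax R) : set (Mhat R E) :=
  [set mpt (c x) x | x in rsupp c].

Definition is_flat (C : set (E -> Rmax R)) (F : set (Mhat R E)) : Prop :=
  [/\ F !=set0, down_closed F &
      forall c u, C c -> circuit_set c u -> circuit_set c `\ u `<=` F -> F u].

Definition vm_closure (C : set (E -> Rmax R)) (S : set (Mhat R E)) :
    set (Mhat R E) :=
  \bigcap_(F in [set F | is_flat C F /\ S `<=` F]) F.

End Closure.

Record algebraic_closure (X : Type) (cl : set X -> set X) : Prop :=
  AlgebraicClosure {
  cl_extensive : forall A, A `<=` cl A;
  cl_monotone : forall A B, A `<=` B -> cl A `<=` cl B;
  cl_idempotent : forall A, cl (cl A) = cl A;
  cl_finitary : forall A,
    cl A = \bigcup_(F in [set F | finite_set F /\ F `<=` A]) cl F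
}.

Record matroidal_closure (R : realType) (E : finType)
    (cl : set (Mhat R E) -> set (Mhat R E)) : Prop := MatroidalClosure {
  mcl_zero : cl set0 mzero;
  mcl_scale : forall (S : set (Mhat R E)) (a : R),
    cl (mscale (Some a) @` S) = mscale (Some a) @` cl S;
  mcl_down : forall S : set (Mhat R E), down_closed (cl S);
  mcl_exchange : forall (S : set (Mhat R E)) (x y : E) (a b : Rmax R),
    cl (S `|` [set mpt b y]) (mpt a x) ->
    exists c : Rmax R, [/\ rmax_le c b, cl (S `|` [set mpt c y]) (mpt a x) &
                           cl (S `|` [set mpt a x]) (mpt c y)];
  mcl_drop : forall (S : set (Mhat R E)) (x : E) (a b : Rmax R),
    cl (S `|` [set mpt b x]) (mpt a x) -> rmax_lt b a -> cl S (mpt a x)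
}.

(* Main.v *)
(* The closure of S turns out to be obtained in a single step: up to downward
   closure, each of its elements is the last element of a circuit whose other
   elements lie below S, because elimination makes this one-step hull a flat.
   The axioms of a matroidal closure are then read off, and a circuit is
   recovered from cl as a vector X with X(u)u in cl (X \ u), where nothing below
   X with the same value at u has this property; this gives injectivity.
   Conversely, given cl, these minimal dependent vectors are the circuits.  By
   (4) and (5) each coordinate of a dependence can be lowered to an attained
   minimum, so minimal dependences exist below any dependence, and minimality at
   one element of the support implies minimality at all of them. *)
Require Import Defs.
From mathcomp Require Import all_boot all_order all_algebra.
From mathcomp Require Import all_classical all_reals.
Local Open Scope classical_set_scope.

Set Implicit Arguments.
Unset Strict Implicit.
Unset Printing Implicit Defensive.

Import Order.TTheory GRing.Theory Num.Theory.
Local Open Scope ring_scope.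

(** * Order and scaling in the tropical semifield *)

Section RmaxOrder.
Context {R : realType}.
Implicit Types a b c : Rmax R.

Lemma rmax_lexx a : rmax_le a a.
Proof. by case: a => /=. Qed.

Lemma rmax_le_trans b a c : rmax_le a b -> rmax_le b c -> rmax_le a c.
Proof. by case: a b c => [a|] [b|] [c|] //=; exact: le_trans. Qed.

Lemma rmax_le_anti a b : rmax_le a b -> rmax_le b a -> a = b.
Proof.
by case: a b => [a|] [b|] //= ab ba; congr Some; apply/le_anti/andP.
Qed.

Lemma rmax_le_total a b : rmax_le a b || rmax_le b a.
Proof. by case: a b => [a|] [b|] //=; exact: le_total. Qed.

Lemma rmax_le_addl a b : rmax_le a (rmax_add a b).
Proof. by rewrite /rmax_add; case: ifP => // _; exact: rmax_lexx. Qed.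

Lemma rmax_le_addr a b : rmax_le b (rmax_add a b).
Proof.
rewrite /rmax_add; case: ifP => [_|h]; first exact: rmax_lexx.
by have := rmax_le_total a b; rewrite h.
Qed.

Lemma rmax_mul_le (r : R) a b :
  rmax_le a b -> rmax_le (rmax_mul (Some r) a) (rmax_mul (Some r) b).
Proof. by case: a b => [a|] [b|] //=; rewrite lerD2l. Qed.

Lemma rmax_mulK (r : R) : cancel (rmax_mul (Some r)) (rmax_mul (Some (- r))).
Proof. by case=> [a|] //=; rewrite addKr. Qed.

Lemma rmax_mulVK (r : R) : cancel (rmax_mul (Some (- r))) (rmax_mul (Some r)).
Proof. by case=> [a|] //=; rewrite addNKr. Qed.

End RmaxOrder.

(** * Vectors under the pointwise order, and downward closure in [Mhat] *)

Section Vectors.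
Context {R : realType} {E : finType}.
Implicit Types (X Y Z : E -> Rmax R) (S T : set (Mhat R E)) (p q : Mhat R E).

Definition vle X Y := forall e, rmax_le (X e) (Y e).

Definition upd X x (a : Rmax R) : E -> Rmax R :=
  fun e => if e == x then a else X e.

Lemma upd_at X x a : upd X x a x = a.
Proof. by rewrite /upd eqxx. Qed.

Lemma upd_neq X x a e : e != x -> upd X x a e = X e.
Proof. by rewrite /upd => /negbTE ->. Qed.

Lemma upd_le X x a : rmax_le a (X x) -> vle (upd X x a) X.
Proof.
by move=> aX e; rewrite /upd; case: eqP => [->//|_]; exact: rmax_lexx.
Qed.

Lemma updC X x y a b : x != y -> upd (upd X x a) y b = upd (upd X y b) x a.
Proof.
move=> xy; apply/funext => e; rewrite /upd.
by case: eqP => [->|//]; rewrite eq_sym (negbTE xy).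
Qed.

Lemma upd_upd X x a b : upd (upd X x a) x b = upd X x b.
Proof. by apply/funext => e; rewrite /upd; case: eqP. Qed.

Lemma vle_refl X : vle X X.
Proof. by move=> e; exact: rmax_lexx. Qed.

Lemma vle_trans Y X Z : vle X Y -> vle Y Z -> vle X Z.
Proof. by move=> XY YZ e; exact: rmax_le_trans (YZ e). Qed.

Lemma vle_upd X Y x a b : rmax_le a b -> vle X Y -> vle (upd X x a) (upd Y x b).
Proof. by move=> ab XY e; rewrite /upd; case: eqP. Qed.

Lemma vle_updr X Y x a : vle X Y -> rmax_le (X x) a -> vle X (upd Y x a).
Proof. by move=> XY Xa e; rewrite /upd; case: eqP => [->|_]. Qed.

Lemma upd_id X x : upd X x (X x) = X.
Proof. by apply/funext => e; rewrite /upd; case: eqP => [->|]. Qed.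

Lemma vle_anti X Y : vle X Y -> vle Y X -> X = Y.
Proof. by move=> XY YX; apply/funext => e; exact: rmax_le_anti. Qed.

Lemma mleE p q : mle p q <->
  match p, q with
  | None, _ => True
  | Some _, None => False
  | Some (r, x), Some (s, y) => x = y /\ r <= s
  end.
Proof.
split=> [[[-> ->]//|[x [[a|] [[b|] [-> ->]]]]]//|].
case: p q => [[r x]|] [[s y]|] //=.
- by move=> [-> rs]; right; exists y, (Some r), (Some s).
- by move=> _; right; exists y, None, (Some s).
- by left.
Qed.

Lemma mle_mpt (a b : Rmax R) (e : E) :
  rmax_le a b -> mle (mpt a e) (mpt b e).
Proof. by move=> ab; right; exists e, a, b. Qed.

Lemma mle_refl p : mle p p.
Proof. by apply/mleE; case: p => [[r x]|]. Qed.

Lemma mle_trans q p r : mle p q -> mle q r -> mle p r.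
Proof.
move=> /mleE pq /mleE qr; apply/mleE; move: pq qr.
case: p q r => [[a x]|] [[b y]|] [[c z]|] //= [-> ab] [-> bc].
by split=> //; exact: le_trans bc.
Qed.

(** [None] is added by hand so that even [dn set0] contains the zero, as every flat does. *)
Definition dn S : set (Mhat R E) :=
  [set p | p = None \/ exists2 s, S s & mle p s].

Lemma dn_sub S : S `<=` dn S.
Proof. by move=> p Sp; right; exists p => //; exact: mle_refl. Qed.

Lemma dn_down S : down_closed (dn S).
Proof.
move=> p q pq [q0|[s Ss qs]]; last by right; exists s => //; exact: mle_trans qs.
by left; move: pq => /mleE; rewrite q0; case: p => [[]|].
Qed.

Lemma dn_le S (a b : Rmax R) e :
  rmax_le a b -> dn S (mpt b e) -> dn S (mpt a e).
Proof. by move=> /mle_mpt ab; exact: dn_down. Qed.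

Lemma dn_mono S T : S `<=` T -> dn S `<=` dn T.
Proof. by move=> ST p [->|[s /ST Ts ps]]; [left|right; exists s]. Qed.

(** Only points over [y] lie below [mpt b y], apart from the zero, which is in [dn S] anyway. *)
Lemma dn_setU1 S (a b : Rmax R) x y :
  dn (S `|` [set mpt b y]) (mpt a x) ->
  dn S (mpt a x) \/ x = y /\ rmax_le a b.
Proof.
move=> [h|[s [Ss|->] h]]; [by left; left|by left; right; exists s|].
move: h => /mleE; case: a b => [a|] [b|] //=; by [left; left|right].
Qed.

Lemma dn_subset_down S T :
  T None -> down_closed T -> S `<=` T -> dn S `<=` T.
Proof. by move=> T0 Td ST p [->//|[s /ST Ts ps]]; exact: Td Ts. Qed.

Lemma mscale_mpt (a b : Rmax R) (e : E) :
  mscale a (mpt b e) = mpt (rmax_mul a b) e.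
Proof. by case: b a => [b|] [a|]. Qed.

Lemma mscaleK (r : R) : cancel (@mscale R E (Some r)) (mscale (Some (- r))).
Proof. by case=> [[a x]|] //=; rewrite addKr. Qed.

Lemma mscaleVK (r : R) : cancel (@mscale R E (Some (- r))) (mscale (Some r)).
Proof. by case=> [[a x]|] //=; rewrite addNKr. Qed.

Lemma dn_scale S (r : R) p :
  dn S p -> dn (mscale (Some r) @` S) (mscale (Some r) p).
Proof.
move=> [->|[s Ss ps]]; first by left.
right; exists (mscale (Some r) s); first by exists s.
by apply/mleE; move: ps => /mleE; case: p s {Ss} => [[a x]|] [[b y]|] //=;
  rewrite lerD2l.
Qed.

Lemma vle_rsupp X Y : vle X Y -> rsupp X `<=` rsupp Y.
Proof.
by move=> XY e; rewrite /rsupp /= => Xe Ye; move: (XY e) Xe; rewrite Ye; case: (X e).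
Qed.

Lemma mpt_SomeE (a : Rmax R) (x : E) (r : R) y :
  mpt a x = Some (r, y) -> a = Some r /\ x = y.
Proof. by case: a => //= a [-> ->]. Qed.

End Vectors.

(** * From circuits to the closure: the one-step hull *)

Section Span.
Context {R : realType} {E : finType}.
Implicit Types (C : set (E -> Rmax R)) (X Y Z : E -> Rmax R).
Implicit Types (S F : set (Mhat R E)) (p q : Mhat R E).

Definition span C S : set (Mhat R E) :=
  [set p | dn S p \/ exists X u, [/\ C X, X u <> None, p = mpt (X u) u &
     forall e, e != u -> dn S (mpt (X e) e)]].

(** To reach a point below [mpt (X u) u], scale the whole circuit down; its other coordinates only
    decrease and stay in [dn S]. *)
Lemma span_down C S : valuated_matroid C -> down_closed (span C S).
Proof.
move=> vm p q pq [Sq|[X [u [CX Xu qE XS]]]]; first by left; exact: dn_down Sq.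
case: p pq => [[r x]|]; last by left; left.
case Xua: (X u) Xu qE => [a|] // _ -> /mleE /= [-> ra].
right; exists (fun e => rmax_mul (Some (r - a)) (X e)), u; split.
- exact: vm_scale.
- by rewrite Xua.
- by rewrite Xua /= subrK.
- move=> e /XS; apply: dn_le; case: (X e) => //= b.
  by rewrite gerDr subr_le0.
Qed.

Lemma span_le C S (a b : Rmax R) e : valuated_matroid C ->
  rmax_le a b -> span C S (mpt b e) -> span C S (mpt a e).
Proof. by move=> vm /mle_mpt ab; exact: span_down. Qed.

(* Induction on the number of coordinates of [X] outside [dn S]: such a
   coordinate [v] is spanned by a circuit [Y], and eliminating [v] between [X]
   and [Y] creates no new coordinate outside [dn S]. *)
Lemma span_circuit C S X u : valuated_matroid C -> C X -> X u <> None ->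
  (forall e, e != u -> span C S (mpt (X e) e)) -> span C S (mpt (X u) u).
Proof.
move=> vm.
pose bad Z := [set e | (e != u) && ~~ `[< dn S (mpt (Z e) e) >]]%SET.
have [n] := ubnP #|bad X|; elim: n X => // n IHn X Xn CX Xu XS.
have [bad0|[v]] := set_0Vmem (bad X).
  right; exists X, u; split=> // e eu; apply: contrapT => /asboolPn Se.
  by have : e \in bad X; [rewrite inE eu Se|rewrite bad0 inE].
rewrite inE => /andP[vu vS].
have [/asboolP Sv|[Y [w [CY Yw vE YS]]]] := XS v vu; first by rewrite Sv in vS.
have Xv : X v <> None by move=> Xv; move/asboolPn: vS; rewrite Xv; apply; left.
have [Xvw ?] : X v = Y w /\ v = w.
  by move: vE; case: (X v) Xv => [a|] // _; case: (Y w) => [b|] //= [-> ->].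
subst w => {vE Yw}.
(* Elimination needs [Y u] strictly below [X u]; otherwise [Y] itself shows that the point lies in
   [dn S]. *)
have [Xu_Yu|Yu_Xu] := boolP (rmax_le (X u) (Y u)).
  by left; apply: dn_le Xu_Yu (YS _ _); rewrite eq_sym.
have [Z [CZ Zv ZuXu Zle]] := vm_elim vm CX CY Xvw Xv Yu_Xu.
have ZS e : e != u -> dn S (mpt (X e) e) -> dn S (mpt (Z e) e).
  move=> eu Xe; have [->|ev] := eqVneq e v; first by rewrite Zv; left.
  apply: dn_le (Zle e) _; rewrite /rmax_add.
  by case: ifP => // _; exact: YS.
rewrite -ZuXu; apply: IHn => //; last 2 first.
- by rewrite ZuXu.
- move=> e eu; have [->|ev] := eqVneq e v; first by rewrite Zv; left; left.
  apply: span_le (Zle e) _ => //; rewrite /rmax_add; case: ifP => _.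
    by left; exact: YS.
  exact: XS.
rewrite ltnS in Xn; apply: leq_trans Xn; apply/proper_card/properP; split.
  apply/fintype.subsetP => e; rewrite !inE => /andP[eu /asboolPn Ze].
  by rewrite eu; apply/asboolPn => /(ZS e eu).
exists v; rewrite !inE ?vu //= negbK; apply/asboolP.
by rewrite Zv; left.
Qed.

Lemma is_flat0 C F : is_flat C F -> F None.
Proof. by move=> [[p Fp] Fd _]; apply: Fd Fp; apply/mleE. Qed.

Lemma flat_circuit C F X u : is_flat C F -> C X -> X u <> None ->
  (forall e, e != u -> F (mpt (X e) e)) -> F (mpt (X u) u).
Proof.
move=> [_ _ Fc] CX Xu XF; apply: Fc CX _ _; first by exists u.
by move=> _ [[e /= _ <-] eu]; apply: XF; apply/eqP => eu'; apply: eu; rewrite eu'.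
Qed.

Lemma span_flat C S : valuated_matroid C -> is_flat C (span C S).
Proof.
move=> vm; split; [by exists None; left; left|exact: span_down|].
move=> X _ CX [u Xu <-] XS; apply: span_circuit => // e eu.
(* A flat discards the point over [u], [span_circuit] the index [u]; these agree because nonzero
   points over distinct elements differ. *)
case Xe : (X e) => [a|]; last by left; left.
rewrite -Xe; apply: XS; split; first by exists e; rewrite /rsupp //= Xe.
move=> /= /esym; rewrite Xe /=; case: (X u) => //= b [_ ue].
by rewrite ue eqxx in eu.
Qed.

(** The span is the least flat containing [S]: it is a flat, and any flat containing [S] contains
    [dn S] and whatever one circuit adds to it. *)
Lemma vm_closureE C S : valuated_matroid C -> vm_closure C S = span C S.
Proof.
move=> vm; apply/seteqP; split=> [p|p pS F [Ff SF]].
  by apply; split; [exact: span_flat|move=> q Sq; left; exact: dn_sub].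
have dnF : dn S `<=` F.
  by apply: dn_subset_down => //; [exact: is_flat0 Ff|case: Ff].
case: pS => [/dnF//|[X [u [CX Xu -> XS]]]].
by apply: flat_circuit CX Xu _ => // e /XS /dnF.
Qed.

(** Membership uses at most one circuit, and each of its finitely many coordinates needs one point
    of [S]. *)
Lemma span_finite C S p : span C S p ->
  exists2 F, finite_set F /\ F `<=` S & span C F p.
Proof.
(* The implication sits under the existential so that [choice] applies to all coordinates;
   intersecting with [S] makes the default [None] harmless. *)
have dnF q : exists s, dn S q -> dn (S `&` [set s]) q.
  have [[->|[s Ss qs]]|Sq] := pselect (dn S q); last by exists None.
    by exists None; left.
  by exists s => _; right; exists s.
move=> [Sp|[X [u [CX Xu pE XS]]]].
  have [s /(_ Sp) ps] := dnF p; exists (S `&` [set s]); last by left.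
  by split; [exact: finite_setIr|exact: subIsetl].
have [f fS] := choice (fun e => dnF (mpt (X e) e)).
exists (S `&` (f @` setT)).
  by split; [apply/finite_setIr/finite_image/finite_finset|exact: subIsetl].
right; exists X, u; split=> // e eu; have := fS e (XS e eu).
by apply: dn_mono; apply: setIS => _ ->; exists e.
Qed.

Lemma vm_closure_algebraic C :
  valuated_matroid C -> algebraic_closure (vm_closure C).
Proof.
move=> vm; have mono A B : A `<=` B -> vm_closure C A `<=` vm_closure C B.
  by move=> AB p pA F [Ff BF]; apply: pA; split=> // q /AB /BF.
split=> //.
- by move=> A p Ap F [_]; exact.
- move=> A; apply/seteqP; split=> p pA F [Ff AF]; apply: pA; split=> // q.
    by apply; split.
  by move=> qA; apply: AF => G [_]; exact.
- move=> A; apply/seteqP; split=> p.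
    rewrite vm_closureE // => /span_finite[F FA pF]; exists F => //.
    by rewrite vm_closureE.
  by move=> [F [_ FA]]; exact: mono.
Qed.

Lemma span_scale C S (r : R) p : valuated_matroid C ->
  span C S p -> span C (mscale (Some r) @` S) (mscale (Some r) p).
Proof.
move=> vm [Sp|[X [u [CX Xu -> XS]]]]; first by left; exact: dn_scale.
right; exists (fun e => rmax_mul (Some r) (X e)), u; split.
- exact: vm_scale.
- by case: (X u) Xu.
- by rewrite mscale_mpt.
- by move=> e /XS /(@dn_scale _ _ _ r); rewrite mscale_mpt.
Qed.

Lemma vm_closure_matroidal C :
  valuated_matroid C -> matroidal_closure (vm_closure C).
Proof.
move=> vm; split.
- by rewrite vm_closureE //; left; left.
- move=> S r; rewrite !vm_closureE //; apply/seteqP; split=> p; last first.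
    by move=> [q qS <-]; exact: span_scale.
  move=> /(span_scale (- r) vm); rewrite image_comp (_ : _ @` S = S).
    by move=> pS; exists (mscale (Some (- r)) p) => //; exact: mscaleVK.
  by rewrite -[RHS]image_id; apply: eq_imagel => q _ /=; exact: mscaleK.
- by move=> S; rewrite vm_closureE //; exact: span_down.
- move=> S x y a b; rewrite vm_closureE //.
  (* If the point is already spanned by [S], exchange holds with [c] the tropical zero. *)
  have easy : span C S (mpt a x) -> exists c, [/\ rmax_le c b,
      vm_closure C (S `|` [set mpt c y]) (mpt a x) &
      vm_closure C (S `|` [set mpt a x]) (mpt c y)].
    rewrite -vm_closureE // => h; exists None; split=> //.
      by apply: (cl_monotone (vm_closure_algebraic vm)) h; exact: subsetUl.
    by rewrite vm_closureE //; left; left.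
  have dnl T : dn S `<=` dn (S `|` T) by apply: dn_mono; exact: subsetUl.
  have dnr (c : Rmax R) z T : dn (T `|` [set mpt c z]) (mpt c z).
    by apply: dn_sub; right.
  move=> [/dn_setU1 [h|[-> ab]]|[X [u [CX Xu /esym aE XS]]]].
  + by apply: easy; left.
  + by exists a; split=> //; rewrite vm_closureE //; left.
  + case: a aE easy => [a|] aE easy; last by apply: easy; left; left.
    have [Xua xu] := mpt_SomeE aE; subst u.
    have [Sy|Sy] := pselect (dn S (mpt (X y) y)).
      apply: easy; right; exists X, x; split=> // e ex.
      have [->//|ey] := eqVneq e y.
      by have /dn_setU1[//|[ey' _]] := XS e ex; rewrite ey' eqxx in ey.
    have [xy|xy] := eqVneq y x.
      subst y; apply: easy; right; exists X, x; split=> // e ex.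
      by have /dn_setU1[//|[ey' _]] := XS e ex; rewrite ey' eqxx in ex.
    have /dn_setU1[//|[_ Xyb]] := XS y xy.
    have XS' e : e != x -> e != y -> dn S (mpt (X e) e).
      move=> /XS/dn_setU1[//|[-> _]]; by rewrite eqxx.
    (* The same circuit, read at [x] and then at [y], gives both memberships. *)
    exists (X y); split=> //; rewrite vm_closureE //; right.
      exists X, x; split=> // e ex; have [->//|ey] := eqVneq e y.
      by apply: dnl; exact: XS'.
    exists X, y; split=> //.
      by move=> Xy; apply: Sy; rewrite Xy; left.
    move=> e ey; have [->|ex] := eqVneq e x; first by rewrite aE; exact: dnr.
    by apply: dnl; exact: XS'.
- move=> S x a b; rewrite !vm_closureE // => h ba.
  (* A circuit ending at [x] uses only its coordinates away from [x], so the adjoined point over [x]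
     cannot contribute. *)
  case: h => [/dn_setU1 [h|[_ ab]]|[X [u [CX Xu aE XS]]]].
  + by left.
  + by rewrite /rmax_lt ab in ba.
  + case: a aE ba => [a|//] /esym aE ba; have [Xua xu] := mpt_SomeE aE; subst u.
    right; exists X, x; split=> // e ex.
    by have /dn_setU1[//|[ey' _]] := XS e ex; rewrite ey' eqxx in ex.
Qed.

(** * Recovering the circuits from the closure: injectivity *)

Definition gr X : set (Mhat R E) := [set mpt (X e) e | e in setT].

Lemma dn_gr X a e : dn (gr X) (mpt a e) <-> rmax_le a (X e).
Proof.
split=> [|aX]; last by apply: dn_le aX _; apply: dn_sub; exists e.
case: a => [a|//] [//|[_ [x _ <-] /mleE /=]].
by case Xx: (X x) => [b|] //= [-> ab]; rewrite Xx.
Qed.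

(** If [X v] were below [Y v], eliminating [u] would give a circuit below [Y] whose support misses
    [u], against incomparability. *)
Lemma circuit_eq C X Y u : valuated_matroid C -> C X -> C Y ->
  vle X Y -> X u = Y u -> X u <> None -> X = Y.
Proof.
move=> vm CX CY XY XYu Xu; apply: vle_anti => // v; apply: contrapT => /negP XYv.
have Yu : Y u <> None by rewrite -XYu.
have [Z [CZ Zu Zv Zle]] := vm_elim vm CY CX (esym XYu) Yu XYv.
apply: (vm_incomparable vm CZ CY).
  by move=> ZY; have : rsupp Z u by rewrite ZY.
apply: vle_rsupp => e; apply: rmax_le_trans (Zle e) _.
by rewrite /rmax_add; case: ifP => _; [exact: XY|exact: rmax_lexx].
Qed.

(** The point of [X] over [u] is in the closure of the other coordinates of [X]; with [u] erased
    there, only a circuit of [D] lying below [X] can put it there. *)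
Lemma vm_closure_circuit_below C D X u : valuated_matroid C ->
  valuated_matroid D -> vm_closure C = vm_closure D -> C X -> X u <> None ->
  exists Y, [/\ D Y, Y u = X u & vle Y X].
Proof.
move=> vmC vmD CD CX Xu; pose S := gr (upd X u None).
have : span C S (mpt (X u) u).
  right; exists X, u; split=> // e eu; apply/dn_gr.
  by rewrite upd_neq //; exact: rmax_lexx.
rewrite -vm_closureE // CD vm_closureE // => -[/dn_gr|[Y [w [DY Yw XY YS]]]].
  by rewrite upd_at; case: (X u) Xu.
have [XuYu ?] : X u = Y w /\ u = w.
  by move: XY; case: (X u) Xu => [a|] // _; case: (Y w) => [b|] //= [-> ->].
subst w; exists Y; split=> // e; have [->|eu] := eqVneq e u.
  by rewrite XuYu; exact: rmax_lexx.
by have /dn_gr := YS e eu; rewrite upd_neq.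
Qed.

(** Passing from [C] to [D] and back gives circuits [Z], [Y], [X], in increasing order, equal at
    [u]; [circuit_eq] in [C] collapses the chain. *)
Lemma vm_closure_subset C D : valuated_matroid C -> valuated_matroid D ->
  vm_closure C = vm_closure D -> C `<=` D.
Proof.
move=> vmC vmD CD X CX.
have [u Xu] : exists u, X u <> None.
  apply: contrapT => /forallNP X0; apply: (vm_nonzero vmC).
  by rewrite (_ : (fun=> None) = X) //; apply/funext => e; have /contrapT := X0 e.
have [Y [DY YXu YX]] := vm_closure_circuit_below vmC vmD CD CX Xu.
have Yu : Y u <> None by rewrite YXu.
have [Z [CZ ZYu ZY]] := vm_closure_circuit_below vmD vmC (esym CD) DY Yu.
have ZX : Z = X.
  apply: (@circuit_eq C _ _ u) => //; rewrite ?ZYu //.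
  by move=> e; exact: rmax_le_trans (YX e).
by rewrite (_ : X = Y) //; apply: vle_anti => //; rewrite -ZX.
Qed.

End Span.

(** * Dependent vectors of a matroidal closure and their minimization *)

Section Circuits.
Context {R : realType} {E : finType} (cl : set (Mhat R E) -> set (Mhat R E)).
Hypotheses (cl_alg : algebraic_closure cl) (cl_mat : matroidal_closure cl).
Implicit Types (X Y Z : E -> Rmax R) (S F : set (Mhat R E)) (p q : Mhat R E).

Let cl0 S : cl S None.
Proof. by apply: (cl_monotone cl_alg) (mcl_zero cl_mat). Qed.

Let cl_sub S T : S `<=` cl T -> cl S `<=` cl T.
Proof. by move=> ST p /(cl_monotone cl_alg ST); rewrite (cl_idempotent cl_alg). Qed.

Let dn_cl S : dn S `<=` cl S.
Proof.
apply: dn_subset_down; [exact: cl0|exact: mcl_down|exact: cl_extensive].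
Qed.

Lemma cl_gr_in X S : (forall e, cl S (mpt (X e) e)) -> cl (gr X) `<=` cl S.
Proof. by move=> XS; apply: cl_sub => _ [e _ <-]. Qed.

Lemma cl_gr_le X a e : rmax_le a (X e) -> cl (gr X) (mpt a e).
Proof. by move=> aX; apply: dn_cl; apply/dn_gr. Qed.

Lemma cl_gr_mono X Y : vle X Y -> cl (gr X) `<=` cl (gr Y).
Proof. by move=> XY; apply: cl_gr_in => e; exact: cl_gr_le. Qed.

(** Translates the one-point extensions in the exchange and drop axioms into updates of vectors. *)
Lemma cl_gr_upd X x a :
  cl (gr (upd X x None) `|` [set mpt a x]) = cl (gr (upd X x a)).
Proof.
apply/seteqP; split; apply: cl_sub => p.
  move=> [[e _ <-]|->]; apply: cl_gr_le; last by rewrite upd_at; exact: rmax_lexx.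
  by rewrite /upd; case: eqP => // _; exact: rmax_lexx.
move=> [e _ <-]; apply: (cl_extensive cl_alg).
by have [->|ex] := eqVneq e x; [right; rewrite upd_at|left; exists e; rewrite ?upd_neq].
Qed.

Lemma cl_gr_drop X x a : cl (gr X) (mpt a x) -> rmax_lt (X x) a ->
  cl (gr (upd X x None)) (mpt a x).
Proof.
move=> h; apply: (mcl_drop cl_mat).
by rewrite cl_gr_upd upd_id.
Qed.

(** This holds trivially when [X u] is [None], so it carries information only on the support. *)
Definition dep X u := cl (gr (upd X u None)) (mpt (X u) u).

Lemma dep_mono X Y u : vle X Y -> X u = Y u -> dep X u -> dep Y u.
Proof. by move=> XY XYu; rewrite /dep XYu; apply: cl_gr_mono; exact: vle_upd. Qed.

(** The exchange axiom, with [S] the graph of [X] erased at [x] and [y], and [b] equal to [X y]. *)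
Lemma dep_exchange X x y : dep X x -> x != y ->
  exists c, [/\ rmax_le c (X y), dep (upd X y c) x & dep (upd X y c) y].
Proof.
move=> Xx xy; pose V := upd X x None.
have depV c : dep (upd X y c) x = cl (gr (upd V y None) `|` [set mpt c y]) (mpt (X x) x).
  by rewrite cl_gr_upd /V updC // /dep upd_neq.
move: Xx; rewrite -{1}[X](upd_id X y) depV.
move=> /(mcl_exchange cl_mat)[c [cX h1 h2]]; exists c; split=> //.
  by rewrite depV.
rewrite /dep upd_at upd_upd; apply: cl_sub h2 => p [[e _ <-]|->]; apply: cl_gr_le.
  by apply: vle_upd => //; exact: upd_le.
by rewrite upd_neq //; exact: rmax_lexx.
Qed.

(** The value at [x] is fixed because scaling down always yields smaller dependent vectors. *)
Definition minimal X x :=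
  dep X x /\ forall Y, vle Y X -> Y x = X x -> dep Y x -> Y = X.

(** If [y] cannot be erased, the [c] given by exchange is the minimum. Were some [b] below [c] to
    suffice, the point of value [c] over [y] would follow from the coordinates off [x] together with
    [b] at [y]; the drop axiom removes [b], and [y] could be erased after all. *)
Lemma dep_minimize_at X x y : dep X x -> x != y -> exists c,
  [/\ rmax_le c (X y), dep (upd X y c) x &
      forall b, rmax_lt b c -> ~ dep (upd X y b) x].
Proof.
move=> Xx xy; have [h|XN] := pselect (dep (upd X y None) x).
  by exists None; split.
have [c [cX cx cy]] := dep_exchange Xx xy; exists c; split=> // b bc bx.
have cyN : cl (gr (upd (upd X y None) x None)) (mpt c y).
  rewrite updC 1?eq_sym // -(upd_upd _ y b); apply: cl_gr_drop; last by rewrite upd_at.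
  move: cy; rewrite /dep upd_at upd_upd; apply: cl_gr_in => e.
  have [->|ex] := eqVneq e x.
    by move: bx; rewrite /dep updC 1?eq_sym // !upd_neq.
  by apply: cl_gr_le; rewrite /upd (negbTE ex); case: eqP => // _; exact: rmax_lexx.
apply: XN; move: cx; rewrite /dep !upd_neq //; apply: cl_gr_in => e.
have [->|ex] := eqVneq e x; first by rewrite upd_at; exact: cl0.
have [->|ey] := eqVneq e y; first by rewrite upd_neq 1?eq_sym // upd_at.
by apply: cl_gr_le; rewrite !upd_neq //; exact: rmax_lexx.
Qed.

(* Coordinates are lowered one at a time: lowering later ones keeps earlier ones
   minimal, and a vector none of whose coordinates can be lowered is minimal. *)
Lemma dep_minimize X x : dep X x -> exists Y, [/\ vle Y X, Y x = X x & minimal Y x].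
Proof.
move=> Xx; suff [Y [YX Yx Yd Ymin]] : exists Y, [/\ vle Y X, Y x = X x, dep Y x &
    forall y b, y \in enum E -> x != y -> rmax_lt b (Y y) -> ~ dep (upd Y y b) x].
  exists Y; split=> //; split=> // Z ZY Zx Zd; apply: vle_anti => // y.
  have [<-|xy] := eqVneq x y; first by rewrite Zx; exact: rmax_lexx.
  apply: contrapT => /negP ZYy; apply: (Ymin y (Z y)) => //; first by rewrite mem_enum.
  apply: dep_mono Zd; last by rewrite upd_neq.
  by apply: vle_updr => //; exact: rmax_lexx.
elim: (enum E) => [|y s [Y [YX Yx Yd Ymin]]].
  by exists X; split=> //; exact: vle_refl.
have [<-|xy] := eqVneq x y.
  exists Y; split=> // z b; rewrite inE => /orP[/eqP ->|]; last exact: Ymin.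
  by rewrite eqxx.
have [c [cY cx cmin]] := dep_minimize_at Yd xy.
exists (upd Y y c); split=> //; [exact: vle_trans (upd_le cY) YX|by rewrite upd_neq|].
move=> z b; have [-> _ _|zy] := eqVneq z y.
  by rewrite upd_at upd_upd; exact: cmin.
rewrite inE (negbTE zy) /= => zs xz; rewrite upd_neq // => bY.
move=> bx; apply: (Ymin z b) => //; apply: dep_mono bx.
  by apply: vle_upd; [exact: rmax_lexx|exact: upd_le].
by rewrite !upd_neq.
Qed.

Lemma minimal_all X x y : minimal X x -> X y <> None -> minimal X y.
Proof.
move=> [Xx Xmin] Xy; have [<-//|xy] := eqVneq x y.
(* If [Y x] were smaller, substituting the dependence [Y] for the coordinate [y] would derive [X x]
   from the coordinates off [x] and [y] together with [Y x]. Dropping [Y x] lets [y] be erased, and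
   minimality at [x] then makes [X y] equal to [None]. *)
have low Y : vle Y X -> Y y = X y -> dep Y y -> Y x = X x.
  move=> YX Yy Yd; apply: rmax_le_anti (YX x) _; apply: contrapT => /negP XYx.
  apply: Xy; rewrite -(Xmin (upd X y None)) ?upd_at ?upd_neq //; first exact: upd_le.
  rewrite /dep upd_neq // -(upd_upd _ x (Y x)); apply: cl_gr_drop; last by rewrite upd_at.
  move: Xx; apply: cl_gr_in => e.
  have [->|ex] := eqVneq e x; first by rewrite upd_at; exact: cl0.
  rewrite upd_neq //; have [->|ey] := eqVneq e y.
    rewrite -Yy; apply: cl_gr_mono Yd => z; rewrite updC 1?eq_sym //.
    by apply: vle_upd => //; apply: vle_updr; rewrite ?rmax_lexx.
  by apply: cl_gr_le; rewrite !upd_neq //; exact: rmax_lexx.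
split.
  have [c [cX cx cy]] := dep_exchange Xx xy.
  by rewrite -(Xmin (upd X y c)) ?upd_neq //; exact: upd_le.
(* Exchange makes [Y], lowered to [c] at [x], dependent at both elements. By [low], [c] equals
   [X x], so nothing was lowered and minimality at [x] applies to [Y]. *)
move=> Y YX Yy Yd; have [] := @dep_exchange Y y x; rewrite 1?eq_sym // => c [cY cy cx].
have YcX : vle (upd Y x c) X by exact: vle_trans (upd_le cY) YX.
apply: Xmin => //; first exact: low.
suff -> : Y = upd Y x c by [].
apply: vle_anti; last exact: upd_le.
apply: vle_updr; first exact: vle_refl.
have := low _ YcX; rewrite upd_at upd_neq 1?eq_sym // => -> //; exact: YX.
Qed.

(** * The valuated matroid of a matroidal closure *)

(** Minimality is asked on the whole support to keep the definition symmetric; one element suffices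
    by [minimal_circuit]. *)
Definition circuits : set (E -> Rmax R) :=
  [set X | (exists u, X u <> None) /\ forall u, X u <> None -> minimal X u].

Lemma minimal_circuit X u : X u <> None -> minimal X u -> circuits X.
Proof. by move=> Xu Xm; split=> [|v]; [exists u|exact: minimal_all Xm]. Qed.

Definition vscale (r : R) X : E -> Rmax R := fun e => rmax_mul (Some r) (X e).

Lemma vscaleK r : cancel (vscale r) (vscale (- r)).
Proof. by move=> X; apply/funext => e; exact: rmax_mulK. Qed.

Lemma vscaleVK r : cancel (vscale (- r)) (vscale r).
Proof. by move=> X; apply/funext => e; exact: rmax_mulVK. Qed.

Lemma vscale_le r X Y : vle X Y -> vle (vscale r X) (vscale r Y).
Proof. by move=> XY e; exact: rmax_mul_le. Qed.

Lemma vscale_None r X e : vscale r X e <> None <-> X e <> None.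
Proof. by rewrite /vscale; case: (X e). Qed.

Lemma dep_scale r X u : dep X u -> dep (vscale r X) u.
Proof.
rewrite /dep => h.
have -> : gr (upd (vscale r X) u None) = mscale (Some r) @` gr (upd X u None).
  rewrite image_comp; apply: eq_imagel => e _ /=.
  by rewrite mscale_mpt /upd; case: eqP.
by rewrite (mcl_scale cl_mat) -mscale_mpt; exists (mpt (X u) u).
Qed.

Lemma circuits_scale r X : circuits X -> circuits (vscale r X).
Proof.
move=> [[u Xu] Xm]; split; first by exists u; apply/vscale_None.
move=> v /vscale_None Xv; have [Xd Xmin] := Xm v Xv; split; first exact: dep_scale.
move=> Y YX Yv Yd; rewrite -(vscaleVK r Y); congr vscale; apply: Xmin.
- by rewrite -(vscaleK r X); exact: vscale_le.
- by rewrite /vscale Yv; exact: rmax_mulK.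
- exact: dep_scale.
Qed.

(** The factor [r] is the minimum of [Y e - X e] over the support of [X], and [u] attains it. *)
Lemma exists_max_scale X Y : (exists u, X u <> None) -> rsupp X `<=` rsupp Y ->
  exists r u, [/\ X u <> None, vscale r X u = Y u & vle (vscale r X) Y].
Proof.
move=> [u0 Xu0] XY; pose d e := odflt 0 (Y e) - odflt 0 (X e).
have Pu0 : X u0 != None by apply/eqP.
case: (@arg_minP _ _ _ u0 (fun e => X e != None) d Pu0) => u /eqP Xu umin.
exists (d u), u; split=> //.
  rewrite /vscale /d; have := XY u Xu; rewrite /rsupp /=.
  by case: (X u) Xu (Y u) => [a|] // _ [b|] //= _; rewrite subrK.
move=> e; rewrite /vscale; case Xe: (X e) => [a|//].
have XeN : X e <> None by rewrite Xe.
have := umin e; rewrite {2}/d Xe => /(_ isT); have := XY e XeN; rewrite /rsupp /=.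
by case: (Y e) => [b|] //= _; rewrite lerBrDr.
Qed.

Lemma circuits_valuated_matroid : valuated_matroid circuits.
Proof.
split.
- by move=> [[u]].
- move=> X Y CX CY XYN XY; apply: XYN; have [Xex _] := CX; have [_ Ymin] := CY.
  (* Scaled until it touches [Y] from below at [u], [X] must equal [Y] by minimality of [Y] at
     [u]. *)
  have [r [u [Xu rXu rXY]]] := exists_max_scale Xex XY.
  have Yu : Y u <> None by rewrite -rXu; apply/vscale_None.
  have [_ /(circuits_scale r) [_ rXm]] := (CY, CX).
  have rXuN : vscale r X u <> None by apply/vscale_None.
  have [rXd _] := rXm u rXuN; have [_ Yum] := Ymin u Yu.
  rewrite -(Yum (vscale r X)) //; apply/seteqP.
  by split=> e; rewrite /rsupp /= vscale_None.
- by move=> X r; exact: circuits_scale.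
- move=> X Y u v [_ Xm] [_ Ym] XYu Xu YXv.
  have Yu : Y u <> None by rewrite -XYu.
  have Xv : X v <> None by move=> Xv; move: YXv; rewrite Xv.
  have uv : u != v.
    by apply/eqP => uv; move: YXv; rewrite -uv XYu /rmax_lt rmax_lexx.
  have [Xvd _] := Xm v Xv; have [Yud _] := Ym u Yu.
  (* At [v] the value is [Y v], not the maximum, so that it stays strictly below [X v] and the drop
     axiom can erase it. *)
  pose W := upd (upd (fun e => rmax_add (X e) (Y e)) u None) v (Y v).
  have WX e : e != u -> e != v -> rmax_le (X e) (W e).
    by move=> eu ev; rewrite /W !upd_neq //; exact: rmax_le_addl.
  have WY e : e != u -> rmax_le (Y e) (W e).
    move=> eu; rewrite /W /upd (negbTE eu).
    by case: eqP => [->|_]; [exact: rmax_lexx|exact: rmax_le_addr].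
  have Wu : cl (gr W) (mpt (X u) u).
    rewrite XYu; apply: cl_gr_mono Yud => e; rewrite /upd.
    by case: eqP => // /eqP eu; exact: WY.
  (* The dependence of [Y] supplies the erased coordinate [u], and that of [X] then yields [X v]. *)
  have : cl (gr W) (mpt (X v) v).
    apply: cl_gr_in Xvd => e.
    have [->|ev] := eqVneq e v; first by rewrite upd_at; exact: cl0.
    rewrite upd_neq //; have [->//|eu] := eqVneq e u.
    by apply: cl_gr_le; exact: WX.
  move=> /cl_gr_drop; rewrite {1}/W upd_at => /(_ YXv).
  rewrite -[upd W v None](upd_upd W v (X v)) => Wd.
  have /dep_minimize[Z [ZW Zv Zm]] : dep (upd W v (X v)) v by rewrite /dep upd_at.
  move: Zv; rewrite upd_at => Zv; have ZvN : Z v <> None by rewrite Zv.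
  exists Z; split=> //; first exact: minimal_circuit ZvN Zm.
    by have := ZW u; rewrite upd_neq // /W upd_neq // upd_at; case: (Z u).
  move=> e; have [->|ev] := eqVneq e v; first by rewrite Zv; exact: rmax_le_addl.
  apply: rmax_le_trans (ZW e) _; rewrite /W upd_upd upd_neq //.
  by apply: (@upd_le _ _ (fun e => rmax_add (X e) (Y e))).
Qed.

(** The coordinatewise maximum of [F] bounds [F], and each of its coordinates is zero or a point of
    [S]. Finitarity thereby reduces to vectors. *)
Lemma finite_le_gr S F : finite_set F -> F `<=` S ->
  exists X, (forall e, dn S (mpt (X e) e)) /\ F `<=` dn (gr X).
Proof.
move=> /finite_seqP[s ->]; elim: s => [|q s IHs] sS.
  by exists (fun=> None); split=> [e|p]; [left|rewrite /= in_nil].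
have [|X [XS sX]] := IHs; first by move=> p ps; apply: sS; rewrite /= inE ps orbT.
have Sq : S q by apply: sS; rewrite /= inE eqxx.
have sub p : p \in q :: s -> p = q \/ dn (gr X) p.
  by rewrite inE => /orP[/eqP|/sX]; [left|right].
case: q Sq sub {sS} => [[r x]|] Sq sub; last first.
  by exists X; split=> // p /sub[->|//]; left.
exists (upd X x (rmax_add (X x) (Some r))); split.
  move=> e; rewrite /upd; case: eqP => // ->; rewrite /rmax_add; case: ifP => // _.
  by apply: (@dn_sub _ _ S).
have Xle : vle X (upd X x (rmax_add (X x) (Some r))).
  by apply: vle_updr; [exact: vle_refl|exact: rmax_le_addl].
move=> p /sub[->|]; last first.
  case: p => [[b y]|]; last by left.
  move=> /(dn_gr X (Some b)) bX; apply/(dn_gr _ (Some b)).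
  exact: rmax_le_trans (Xle y).
by apply/(dn_gr _ (Some r)); rewrite upd_at; exact: rmax_le_addr.
Qed.

Lemma vm_closure_circuits : vm_closure circuits = cl.
Proof.
apply/funext => S; rewrite vm_closureE; last exact: circuits_valuated_matroid.
apply/seteqP; split=> p.
  move=> [/dn_cl//|[X [u [[_ Xm] Xu -> XS]]]]; have [Xd _] := Xm u Xu.
  apply: cl_gr_in Xd => e; rewrite /upd; case: eqP => [_|/eqP eu]; first exact: cl0.
  by apply: dn_cl; exact: XS.
case: p => [[a x]|_]; last by left; left.
rewrite (cl_finitary cl_alg) => -[F [Ffin FS] Fp].
have [X [XS FX]] := finite_le_gr Ffin FS.
have Xp : cl (gr X) (mpt (Some a) x).
  by apply: cl_sub Fp => q /FX; exact: dn_cl.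
(* When [a] exceeds [X x], the drop axiom makes [X] with value [a] at [x] dependent there; a minimal
   vector below it is the required circuit. *)
have [aX|Xa] := boolP (rmax_le (Some a) (X x)).
  by left; apply: (dn_le aX).
have /dep_minimize[Z [ZX Zx Zm]] : dep (upd X x (Some a)) x.
  by rewrite /dep upd_at upd_upd; exact: cl_gr_drop.
move: Zx; rewrite upd_at => Zx; have ZxN : Z x <> None by rewrite Zx.
right; exists Z, x; split=> //; first exact: minimal_circuit ZxN Zm.
  by rewrite Zx.
by move=> e ex; apply: dn_le (ZX e) _; rewrite upd_neq.
Qed.

End Circuits.

(** * The one-to-one correspondence *)

Theorem theoremA (R : realType) (E : finType) :
  set_bij
    [set C : set (E -> Rmax R) | valuated_matroid C]
    [set cl : set (Mhat R E) -> set (Mhat R E) |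
       algebraic_closure cl /\ matroidal_closure cl]
    vm_closure.
Proof.
split.
- move=> C vm /=; split; [exact: vm_closure_algebraic|exact: vm_closure_matroidal].
- move=> C D; rewrite !inE => vmC vmD CD.
  by apply/seteqP; split; exact: vm_closure_subset.
- move=> cl [cl_alg cl_mat]; exists (circuits cl).
    exact: circuits_valuated_matroid.
  exact: vm_closure_circuits.
Qed.
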